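(* For any finite multiset $B$ of integers with $|B|<0$ (sum of elements negative), the sweep map is a bijection from $\mathcal D^o_B$ to $\mathcal D^o_B$.
   Context: An incomplete Dyck path of type $B$ is a sequence $(b_1,\dots,b_N)$ with multiset of entries $B$ such that $a:=-(b_1+\cdots+b_N)>0$ and $a+b_1+\cdots+b_i\ge0$ for all $i$. Its $i$-th arrow is the vector $(1,b_i)$ with starting rank $r_i=a+b_1+\cdots+b_{i-1}$ (so $r_1=a$ and the path ends at level $0$). $\mathcal D^o_B$ is the set of incomplete Dyck paths of type $B$. The sweep map sends such a path to the sequence of its steps $b_i$ listed in order of increasing starting rank $0,1,2,\dots$, with arrows of equal starting rank listed from right to left (decreasing $i$). *)

(* Defs.v *)
From mathcomp Require Import all_boot all_order all_algebra.
From mathcomp Require Import finmap multiset.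
From mathcomp Require Import classical_sets functions.

Set Implicit Arguments.
Unset Strict Implicit.
Unset Printing Implicit Defensive.

Import Order.TTheory GRing.Theory Num.Theory.

Local Open Scope classical_set_scope.
Local Open Scope ring_scope.
Local Open Scope mset_scope.

(* The level a at which the path starts, so that it ends at level 0. *)
Definition start_level (p : seq int) : int := - \sum_(b <- p) b.

(* The level a + b_1 + ... + b_i reached after i steps. With positions counted
   from 0 (the k-th arrow sits at position k - 1), this is also the starting
   rank of the arrow at position i: level p i = r_{i+1}. *)
Definition level (p : seq int) (i : nat) : int :=
  start_level p + \sum_(b <- take i p) b.

Definition incomplete_dyck (B : {mset int}) : set (seq int) :=
  [set p | [/\ seq_mset p = B,
               0 < start_level p
             & forall i : nat, (i <= size p)%N -> 0 <= level p i]].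

(* Order in which positions are read: increasing starting rank, and right to
   left (decreasing position) among arrows of equal starting rank. *)
Definition sweep_le (p : seq int) : rel nat :=
  fun i j => (level p i < level p j)
             || ((level p i == level p j) && (j <= i)%N).

Definition sweep (p : seq int) : seq int :=
  [seq nth 0 p i | i <- sort (sweep_le p) (iota 0 (size p))].

(* Main.v *)
(* The map preserves paths: the letters read first by the sweep are the steps
   starting below some level K, and as the levels truncated at K telescope, the
   sum of these steps is bounded below by the total change of the truncated
   level. As there are finitely many paths, it remains to prove injectivity.
   Let p and q have the same image w, and let x_i and y_i be the levels at which
   the i-th letter of w starts in p and in q. In a path, the starting levels
   together with 0 form the same multiset as the ending levels together with the
   first level a. So the pairs (x_i, y_i) and (0, 0) on the one side,
   (x_i + w_i, y_i + w_i) and (a, a) on the other side, have the same first and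
   second components, and also the same sum of squared differences. The first
   family is sorted in both components, hence by the equality case of the
   rearrangement inequality the two families agree as multisets.
   If x_i > y_i for some step of p, the pair of levels where this step ends is
   also a pair of starting levels, so the same difference occurs at some step of
   p leaving the level just reached, and is at least as large at the last one,
   which is a later step. This cannot go on forever. Hence x = y, and the order
   in which ties are read then determines the path. *)

Require Import Defs.
From mathcomp Require Import all_boot all_order all_algebra.
From mathcomp Require Import finmap multiset.
From mathcomp Require Import classical_sets functions cardinality.
From mathcomp Require Import zify lra.

Set Implicit Arguments.
Unset Strict Implicit.

Import Order.TTheory GRing.Theory Num.Theory.

Local Open Scope ring_scope.
Local Open Scope mset_scope.

Lemma finite_set_inj_bij (T : choiceType) (A : set T) (f : T -> T) :
  finite_set A -> set_fun A A f -> set_inj A f -> set_bij A A f.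
Proof.
move=> /finite_fsetP[X ->] f_fun f_inj; split=> //.
have /eqP imX : [fset f x | x in X]%fset == X.
  rewrite eqEfcard card_in_imfset ?leqnn ?andbT; last first.
    by move=> x y xX yX; apply: f_inj; rewrite inE.
  by apply/fsubsetP => _ /imfsetP[x xX ->]; exact: f_fun.
by move=> y /=; rewrite -{1}imX => /imfsetP[x xX ->]; exists x.
Qed.

Section Comonotone.
Context {d1 d2 : Order.disp_t} {T1 : orderType d1} {T2 : orderType d2}.
Implicit Types (t u : T1 * T2) (S T : seq (T1 * T2)).

Definition comonotone S : bool :=
  pairwise (fun u v => (u.1 <= v.1)%O && (u.2 <= v.2)%O) S.

Definition same_marginals S T : bool :=
  perm_eq (unzip1 S) (unzip1 T) && perm_eq (unzip2 S) (unzip2 T).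

Definition strictly_submodular (R : numDomainType) (c : T1 -> T2 -> R) : Prop :=
  forall x x' y y', (x < x')%O -> (y < y')%O ->
    c x y + c x' y' < c x y' + c x' y.

Lemma same_marginals_cons u S T :
  same_marginals (u :: S) (u :: T) = same_marginals S T.
Proof. by rewrite /same_marginals /= !perm_cons. Qed.

Lemma same_marginals_perml S S' T :
  perm_eq S S' -> same_marginals S T = same_marginals S' T.
Proof.
by move=> SS'; rewrite /same_marginals !(permPl (perm_map _ SS')).
Qed.

Lemma comonotone_head_le t T S u :
    comonotone (t :: T) -> same_marginals S (t :: T) -> u \in S ->
  (t.1 <= u.1)%O /\ (t.2 <= u.2)%O.
Proof.
rewrite /comonotone /= => /andP[/allP t_min _].
case/andP=> /perm_mem S1 /perm_mem S2 uS.
split.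
- have : u.1 \in unzip1 (t :: T) by rewrite -S1 map_f.
  by rewrite inE => /predU1P[->//|/mapP[v /t_min /andP[? _] ->]].
- have : u.2 \in unzip2 (t :: T) by rewrite -S2 map_f.
  by rewrite inE => /predU1P[->//|/mapP[v /t_min /andP[_ ?] ->]].
Qed.

Lemma same_marginals_crossing t T S :
    same_marginals S (t :: T) -> t \notin S ->
  exists x y S',
    [/\ x != t.1, y != t.2 & perm_eq S [:: (t.1, y), (x, t.2) & S']].
Proof.
case: t => t1 t2 /andP[/perm_mem S1 /perm_mem S2] tNS.
have /mapP[[t1' y] uS /= t1E] : t1 \in unzip1 S by rewrite S1 mem_head.
have /mapP[[x t2'] vS /= t2E] : t2 \in unzip2 S by rewrite S2 mem_head.
rewrite -{t1'}t1E in uS; rewrite -{t2'}t2E in vS.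
have y_neq : y != t2 by apply: contraNneq tNS => <-.
have x_neq : x != t1 by apply: contraNneq tNS => <-.
have v_rem : (x, t2) \in rem (t1, y) S.
  by move: vS; rewrite (perm_mem (perm_to_rem uS)) inE xpair_eqE (negPf x_neq).
exists x, y, (rem (x, t2) (rem (t1, y) S)); split=> //.
by rewrite (permPl (perm_to_rem uS)) perm_cons perm_to_rem.
Qed.

Lemma same_marginals_uncross x y t S T :
  same_marginals [:: (t.1, y), (x, t.2) & S] (t :: T) ->
  same_marginals ((x, y) :: S) T.
Proof.
case/andP=> ST1; rewrite /= (perm_catCA [:: y] [:: t.2]) => ST2.
by rewrite -(same_marginals_cons t); apply/andP.
Qed.

Lemma rearrangement_leif (R : numDomainType) (c : T1 -> T2 -> R) S T :
    strictly_submodular c -> comonotone T -> same_marginals S T ->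
  \sum_(u <- T) c u.1 u.2 <= \sum_(u <- S) c u.1 u.2 ?= iff perm_eq S T.
Proof.
move=> c_sub; elim: T S => [|t T IH] S T_com ST.
  case/andP: ST => /perm_size; rewrite size_map => /size0nil -> _.
  exact/leif_refl.
have [_ T_com'] := andP T_com.
have [tS|tNS] := boolP (t \in S).
  have remS := perm_to_rem tS.
  rewrite (same_marginals_perml _ remS) same_marginals_cons in ST.
  rewrite (perm_big _ remS) (permPl remS) perm_cons !big_cons /=.
  have head_eq : c t.1 t.2 <= c t.1 t.2 ?= iff true by exact/leif_refl.
  exact: leifD head_eq (IH _ T_com' ST).
have [x [y [S' [x_neq y_neq permS]]]] := same_marginals_crossing ST tNS.
have head_le u := comonotone_head_le (u := u) T_com ST.
have /head_le[_ /= y_ge] : (t.1, y) \in S by rewrite (perm_mem permS) mem_head.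
have /head_le[/= x_ge _] : (x, t.2) \in S.
  by rewrite (perm_mem permS) !inE eqxx /= orbT.
have uncross : c t.1 t.2 + c x y < c t.1 y + c x t.2.
  by apply: c_sub; rewrite lt_neqAle eq_sym ?x_neq ?y_neq.
have ST' : same_marginals ((x, y) :: S') T.
  move: ST; rewrite (same_marginals_perml _ permS).
  exact: same_marginals_uncross.
apply/leifP; rewrite ifN; last first.
  by apply: contra tNS => /perm_mem ->; exact: mem_head.
have [T_le _] := IH _ T_com' ST'; rewrite big_cons /= in T_le.
rewrite (perm_big _ permS) !big_cons /= [ltRHS]addrA.
apply: (@le_lt_trans _ _ (c t.1 t.2 + c x y + \sum_(u <- S') c u.1 u.2)).
  by rewrite -addrA lerD2l.
by rewrite ltrD2r.
Qed.

End Comonotone.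

Lemma sqr_dist_submodular (R : realDomainType) :
  strictly_submodular (fun x y : R => (x - y) ^+ 2).
Proof.
move=> x x' y y' lt_x lt_y.
have : 0 < (x' - x) * (y' - y) by rewrite mulr_gt0 ?subr_gt0.
by rewrite !expr2; lra.
Qed.

Lemma min_le_sum_low_increments (R : realDomainType) (f : nat -> R) (K : R)
    (low : pred nat) (N : nat) :
    (forall i, (i < N)%N -> low i -> f i <= K) ->
    (forall i, (i < N)%N -> ~~ low i -> K <= f i) ->
  Num.min (f N) K <= f 0%N + \sum_(0 <= i < N | low i) (f i.+1 - f i).
Proof.
move=> f_low f_high; pose g i := Num.min (f i) K.
have g_incr i : (i < N)%N -> g i.+1 - g i <= if low i then f i.+1 - f i else 0.
  move=> iN; have := f_low i iN; have := f_high i iN; rewrite /g !minElt.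
  by case: (low i) => [_ /(_ isT)|/(_ isT) + _] => ?; do 2!case: ifP; lra.
have g_total : g N - g 0%N <= \sum_(0 <= i < N | low i) (f i.+1 - f i).
  rewrite -(telescope_sumr g) // [leRHS]big_mkcond.
  by apply: ler_sum_nat => i /andP[_]; exact: g_incr.
have g0_le : g 0%N <= f 0%N by rewrite ge_min lexx.
by rewrite -/(g N); lra.
Qed.

Section Levels.
Implicit Types p q : seq int.

Definition nonneg_levels p : Prop :=
  forall i, (i <= size p)%N -> 0 <= level p i.

Lemma level0 p : level p 0 = start_level p.
Proof. by rewrite /level take0 big_nil addr0. Qed.

Lemma level_size p : level p (size p) = 0.
Proof. by rewrite /level take_size addNr. Qed.

Lemma levelS p i : (i < size p)%N -> level p i.+1 = level p i + nth 0 p i.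
Proof.
by move=> ip; rewrite /level (take_nth 0) // -cats1 big_cat big_seq1 addrA.
Qed.

Lemma eq_level p q n :
    start_level p = start_level q -> (n <= size p)%N -> (n <= size q)%N ->
    (forall i, (i < n)%N -> nth 0 p i = nth 0 q i) ->
  level p n = level q n.
Proof.
move=> eq_start np nq eq_nth; rewrite /level eq_start.
congr (_ + _); rewrite -!(map_nth_iota0 0) // !big_map.
by apply: eq_big_seq => i; rewrite mem_iota => /eq_nth.
Qed.

End Levels.

Section SweepOrder.
Implicit Type p : seq int.

Definition sweep_order p : seq nat := sort (sweep_le p) (iota 0 (size p)).

Definition sweep_pos p (i : nat) : nat := nth 0%N (sweep_order p) i.

Definition sweep_index p (n : nat) : nat := index n (sweep_order p).

Definition sweep_level p (i : nat) : int := level p (sweep_pos p i).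

Lemma sweep_le_refl p : reflexive (sweep_le p).
Proof. by move=> i; rewrite /sweep_le eqxx leqnn orbT. Qed.

Lemma sweep_le_total p : total (sweep_le p).
Proof.
move=> i j; rewrite /sweep_le.
by case: (ltgtP (level p i) (level p j)) => //= _; exact: leq_total.
Qed.

Lemma sweep_le_trans p : transitive (sweep_le p).
Proof.
move=> j i k; rewrite /sweep_le => /orP[ij|/andP[/eqP-> ij]].
  by case/orP=> [jk|/andP[/eqP<- _]]; rewrite ?ij // (lt_trans ij jk).
by case/orP=> [->//|/andP[-> jk]]; rewrite (leq_trans jk ij) orbT.
Qed.

Lemma perm_sweep_order p : perm_eq (sweep_order p) (iota 0 (size p)).
Proof. by rewrite perm_sort. Qed.

Lemma sweep_order_uniq p : uniq (sweep_order p).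
Proof. by rewrite sort_uniq iota_uniq. Qed.

Lemma size_sweep_order p : size (sweep_order p) = size p.
Proof. by rewrite size_sort size_iota. Qed.

Lemma mem_sweep_order p n : (n \in sweep_order p) = (n < size p)%N.
Proof. by rewrite (perm_mem (perm_sweep_order p)) mem_iota. Qed.

Lemma sweep_pos_lt p i : (i < size p)%N -> (sweep_pos p i < size p)%N.
Proof. by move=> ip; rewrite -mem_sweep_order mem_nth ?size_sweep_order. Qed.

Lemma sweep_index_lt p n : (n < size p)%N -> (sweep_index p n < size p)%N.
Proof.
by move=> np; rewrite -[ltnRHS]size_sweep_order index_mem mem_sweep_order.
Qed.

Lemma sweep_posK p i : (i < size p)%N -> sweep_index p (sweep_pos p i) = i.
Proof.
by move=> ip; apply: index_uniq; rewrite ?size_sweep_order ?sweep_order_uniq.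
Qed.

Lemma sweep_indexK p n : (n < size p)%N -> sweep_pos p (sweep_index p n) = n.
Proof. by move=> np; rewrite /sweep_pos nth_index ?mem_sweep_order. Qed.

Lemma sweep_level_ge0 p i :
  nonneg_levels p -> (i < size p)%N -> 0 <= sweep_level p i.
Proof. by move=> p_nneg ip; exact/p_nneg/ltnW/sweep_pos_lt. Qed.

Lemma sweep_index_sweep_le p m n : (m < size p)%N -> (n < size p)%N ->
  (sweep_index p m <= sweep_index p n)%N -> sweep_le p m n.
Proof.
rewrite -!mem_sweep_order; apply: sorted_leq_index.
- exact: sweep_le_trans.
- exact: sweep_le_refl.
- exact/sort_sorted/sweep_le_total.
Qed.

Lemma sweep_index_level p m n : (m < size p)%N -> (n < size p)%N ->
  (sweep_index p m <= sweep_index p n)%N -> level p m <= level p n.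
Proof.
move=> mp np /(sweep_index_sweep_le mp np).
by case/orP=> [/ltW//|/andP[/eqP->]].
Qed.

Lemma sweep_level_homo p i j :
  (i <= j)%N -> (j < size p)%N -> sweep_level p i <= sweep_level p j.
Proof.
move=> ij jp; have ip := leq_ltn_trans ij jp.
by apply: sweep_index_level; rewrite ?sweep_posK // sweep_pos_lt.
Qed.

Lemma sweep_index_tie p m n :
    (m < size p)%N -> (n < size p)%N -> level p m = level p n ->
  (sweep_index p m <= sweep_index p n)%N = (n <= m)%N.
Proof.
move=> mp np eq_lev.
have tie k l : (k < size p)%N -> (l < size p)%N -> level p k = level p l ->
    (sweep_index p k <= sweep_index p l)%N -> (l <= k)%N.
  move=> kp lp eq_kl /(sweep_index_sweep_le kp lp).
  by rewrite /sweep_le eq_kl ltxx eqxx.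
apply/idP/idP => [|nm]; first exact: tie.
rewrite leqNgt; apply/negP => lt_index.
have /anti_leq mn : (m <= n <= m)%N by rewrite nm (tie n m) // ltnW.
by rewrite mn ltnn in lt_index.
Qed.

Lemma perm_sweep p : perm_eq (sweep p) p.
Proof.
rewrite (permPl (perm_map _ (perm_sweep_order p))).
by rewrite -[X in perm_eq _ X](mkseq_nth 0).
Qed.

Lemma size_sweep p : size (sweep p) = size p.
Proof. exact/perm_size/perm_sweep. Qed.

Lemma start_level_sweep p : start_level (sweep p) = start_level p.
Proof. by rewrite /start_level (perm_big _ (perm_sweep p)). Qed.

Lemma nth_sweep p i :
  (i < size p)%N -> nth 0 (sweep p) i = nth 0 p (sweep_pos p i).
Proof. by move=> ip; rewrite (nth_map 0%N) ?size_sweep_order. Qed.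

Lemma level_sweep p n :
  level (sweep p) n =
  level p 0 + \sum_(0 <= i < size p | (sweep_index p i < n)%N)
                 (level p i.+1 - level p i).
Proof.
rewrite {1}/level start_level_sweep level0 -map_take big_map; congr (_ + _).
rewrite (eq_big_seq (fun i => level p i.+1 - level p i)); last first.
  move=> i /mem_take; rewrite mem_sweep_order => ip.
  by rewrite levelS // addrC addKr.
rewrite -[RHS]big_filter; apply/perm_big/uniq_perm.
- exact/take_uniq/sweep_order_uniq.
- by rewrite filter_uniq ?iota_uniq.
move=> i; rewrite mem_filter mem_index_iota -mem_sweep_order.
have [iN|iNN] := boolP (i \in sweep_order p); first by rewrite in_take ?andbT.
by rewrite /= andbF; apply: contraNF iNN; exact: mem_take.
Qed.

Lemma sweep_nonneg p : nonneg_levels p -> nonneg_levels (sweep p).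
Proof.
move=> p_nneg n; rewrite size_sweep leq_eqVlt => /predU1P[->|np].
  by rewrite -size_sweep level_size.
have pos_np := sweep_pos_lt np.
have low_le i : (i < size p)%N -> (sweep_index p i < n)%N ->
    level p i <= sweep_level p n.
  by move=> ip i_n; apply: sweep_index_level; rewrite ?sweep_posK // ltnW.
have high_ge i : (i < size p)%N -> ~~ (sweep_index p i < n)%N ->
    sweep_level p n <= level p i.
  move=> ip; rewrite -leqNgt => n_i.
  by apply: sweep_index_level; rewrite ?sweep_posK.
rewrite level_sweep; apply: le_trans (min_le_sum_low_increments low_le high_ge).
by rewrite level_size le_min lexx sweep_level_ge0.
Qed.

End SweepOrder.

Section SameSweep.
Variables p q : seq int.
Hypothesis eq_sweep : sweep p = sweep q.

Lemma eq_size_of_sweep : size p = size q.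
Proof. by rewrite -(size_sweep p) eq_sweep size_sweep. Qed.

Lemma eq_start_level_of_sweep : start_level p = start_level q.
Proof. by rewrite -(start_level_sweep p) eq_sweep start_level_sweep. Qed.

Lemma eq_nth_of_sweep_index n : (n < size p)%N ->
  sweep_index p n = sweep_index q n -> nth 0 p n = nth 0 q n.
Proof.
move=> np eq_n; have nq : (n < size q)%N by rewrite -eq_size_of_sweep.
rewrite -{1}(sweep_indexK np) -nth_sweep ?sweep_index_lt // eq_sweep eq_n.
by rewrite nth_sweep ?sweep_index_lt ?sweep_indexK.
Qed.

End SameSweep.

Definition sweep_end_level (p : seq int) (i : nat) : int :=
  level p (sweep_pos p i).+1.

Lemma sweep_end_levelE (p : seq int) (i : nat) :
  (i < size p)%N -> sweep_end_level p i = sweep_level p i + nth 0 (sweep p) i.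
Proof. by move=> ip; rewrite nth_sweep // -levelS ?sweep_pos_lt. Qed.

Lemma perm_mkseq_sweep_pos (T : eqType) (f : nat -> T) (p : seq int) :
  perm_eq (mkseq (f \o sweep_pos p) (size p)) (mkseq f (size p)).
Proof.
rewrite /mkseq (map_comp f (sweep_pos p)); apply: perm_map.
by rewrite -{1}size_sweep_order map_nth_iota0 // take_size perm_sweep_order.
Qed.

Lemma perm_end_levels (p : seq int) :
  perm_eq (start_level p :: mkseq (sweep_end_level p) (size p))
          (0 :: mkseq (sweep_level p) (size p)).
Proof.
have ends : perm_eq (start_level p :: mkseq (sweep_end_level p) (size p))
                    (mkseq (level p) (size p).+1).
  rewrite /mkseq /= level0 perm_cons (iotaDl 1 0) -map_comp.
  exact: (perm_mkseq_sweep_pos (level p \o succn)).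
have starts : perm_eq (0 :: mkseq (sweep_level p) (size p))
                      (mkseq (level p) (size p).+1).
  rewrite mkseqS level_size perm_sym perm_rcons perm_cons perm_sym.
  exact: (perm_mkseq_sweep_pos (level p)).
by rewrite (permPl ends) perm_sym.
Qed.

Section LevelPairs.
Variables p q : seq int.
Hypotheses (p_nneg : nonneg_levels p) (q_nneg : nonneg_levels q).
Hypothesis eq_sweep : sweep p = sweep q.

Let eq_size : size p = size q := eq_size_of_sweep eq_sweep.

Definition start_level_pairs : seq (int * int) :=
  (0, 0) :: mkseq (fun i => (sweep_level p i, sweep_level q i)) (size p).

Definition end_level_pairs : seq (int * int) :=
  (start_level p, start_level q)
    :: mkseq (fun i => (sweep_end_level p i, sweep_end_level q i)) (size p).

Lemma same_marginals_level_pairs :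
  same_marginals end_level_pairs start_level_pairs.
Proof.
apply/andP; split; rewrite /= /unzip1 /unzip2 -!map_comp.
  exact: perm_end_levels.
by rewrite eq_size; exact: perm_end_levels.
Qed.

Lemma comonotone_start_level_pairs : comonotone start_level_pairs.
Proof.
rewrite /comonotone /=; apply/andP; split.
  apply/allP=> _ /mapP[i + ->]; rewrite mem_iota add0n /= => ip.
  by rewrite !sweep_level_ge0 // -eq_size.
apply/(pairwiseP (0, 0)) => i j; rewrite !inE size_mkseq => ip jp ij.
by rewrite !nth_mkseq //= !sweep_level_homo -?eq_size // ltnW.
Qed.

Lemma sub_sweep_end_level i : (i < size p)%N ->
  sweep_end_level p i - sweep_end_level q i = sweep_level p i - sweep_level q i.
Proof.
move=> ip; rewrite !sweep_end_levelE -?eq_size // eq_sweep.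
by rewrite opprD addrACA subrr addr0.
Qed.

Lemma sum_sqr_dist_level_pairs :
  \sum_(u <- end_level_pairs) (u.1 - u.2) ^+ 2 =
  \sum_(u <- start_level_pairs) (u.1 - u.2) ^+ 2.
Proof.
rewrite !big_cons !big_map /= (eq_start_level_of_sweep eq_sweep) !subrr.
congr (_ + _); apply: eq_big_seq => i; rewrite mem_iota add0n /= => ip.
by rewrite sub_sweep_end_level.
Qed.

Lemma perm_level_pairs : perm_eq end_level_pairs start_level_pairs.
Proof.
have [_ <-] := rearrangement_leif (@sqr_dist_submodular int)
  comonotone_start_level_pairs same_marginals_level_pairs.
by rewrite sum_sqr_dist_level_pairs.
Qed.

Definition excess (n : nat) : int :=
  level p n - sweep_level q (sweep_index p n).

Lemma excess_recurs n : (n < size p)%N -> 0 < excess n ->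
  exists m, [/\ (m < size p)%N, level p m = level p n.+1 & excess m = excess n].
Proof.
move=> np n_pos; set i := sweep_index p n.
have ip : (i < size p)%N := sweep_index_lt np.
have p_end : sweep_end_level p i = level p n.+1.
  by rewrite /sweep_end_level sweep_indexK.
have excess_end : level p n.+1 - sweep_end_level q i = excess n.
  by rewrite -p_end sub_sweep_end_level // {1}/sweep_level sweep_indexK.
have : (level p n.+1, sweep_end_level q i) \in start_level_pairs.
  rewrite -(perm_mem perm_level_pairs) -p_end inE.
  by rewrite (map_f (fun j => (_ p j, _ q j))) ?mem_iota ?orbT.
rewrite inE xpair_eqE => /orP[/andP[/eqP p0 /eqP q0]|].
  by rewrite -excess_end p0 q0 subrr ltxx in n_pos.
case/mapP=> k; rewrite mem_iota add0n => kp [p_k q_k].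
exists (sweep_pos p k); split; rewrite ?sweep_pos_lt //.
by rewrite -excess_end p_k q_k /excess sweep_posK.
Qed.

(* If the recurrence of the excess precedes n, step n + 1 leaves the same level
   and, being further to the right, is read before it. *)
Lemma excess_persists n : (n < size p)%N -> 0 < excess n ->
  exists2 m, (n < m < size p)%N & excess n <= excess m.
Proof.
move=> np n_pos; have [m [mp level_m excess_m]] := excess_recurs np n_pos.
have [nm|mn] := ltnP n m; first by exists m; rewrite ?nm ?excess_m.
have mq : (sweep_index p m < size q)%N by rewrite -eq_size sweep_index_lt.
move: np; rewrite leq_eqVlt => /predU1P[n_last|n1p].
  have := sweep_level_ge0 q_nneg mq.
  by move: n_pos; rewrite -excess_m /excess level_m n_last level_size; lia.
exists n.+1; rewrite ?ltnSn // -excess_m /excess level_m lerD2l lerN2.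
by rewrite sweep_level_homo // sweep_index_tie // ltnW.
Qed.

Lemma excess_le0 n : (n < size p)%N -> excess n <= 0.
Proof.
have [k] := ubnP (size p - n); elim: k n => // k IH n lt_k np.
rewrite leNgt; apply/negP => n_pos.
have [m /andP[nm mp] le_m] := excess_persists np n_pos.
have lt_m : (size p - m < k)%N by lia.
by have := lt_le_trans n_pos le_m; rewrite ltNge IH.
Qed.

Lemma sweep_level_le i : (i < size p)%N -> sweep_level p i <= sweep_level q i.
Proof.
move=> ip; have := excess_le0 (sweep_pos_lt ip).
by rewrite /excess sweep_posK // subr_le0.
Qed.

End LevelPairs.

Lemma sweep_index_le_of_prefix (p q : seq int) (n : nat) :
    size p = size q ->
    (forall i, (i < size p)%N -> sweep_level p i = sweep_level q i) ->
    (n < size p)%N -> level p n = level q n ->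
    (forall m, (m < n)%N -> sweep_index p m = sweep_index q m) ->
  (sweep_index q n <= sweep_index p n)%N.
Proof.
move=> eq_size eq_sweep_level np eq_n eq_index.
have nq : (n < size q)%N by rewrite -eq_size.
have ip : (sweep_index q n < size p)%N by rewrite eq_size sweep_index_lt.
pose m := sweep_pos p (sweep_index q n).
have mp : (m < size p)%N := sweep_pos_lt ip.
have index_m : sweep_index p m = sweep_index q n := sweep_posK ip.
have level_m : level p n = level p m.
  rewrite eq_n -[RHS]/(sweep_level p _) eq_sweep_level //.
  by rewrite /sweep_level sweep_indexK.
rewrite leqNgt; apply/negP => lt_index.
have : (m <= n)%N by rewrite -(sweep_index_tie np mp level_m) index_m ltnW.
rewrite leq_eqVlt => /predU1P[mn|mn].
  by rewrite -index_m mn ltnn in lt_index.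
have mq : (m < size q)%N by rewrite -eq_size.
have nm : n = m.
  by rewrite -[LHS](sweep_indexK nq) -index_m (eq_index m mn) sweep_indexK.
by rewrite nm ltnn in mn.
Qed.

Lemma sweep_inj (p q : seq int) :
  nonneg_levels p -> nonneg_levels q -> sweep p = sweep q -> p = q.
Proof.
move=> p_nneg q_nneg eq_sweep; have eq_size := eq_size_of_sweep eq_sweep.
have eq_start := eq_start_level_of_sweep eq_sweep.
have eq_sweep_level i : (i < size p)%N -> sweep_level p i = sweep_level q i.
  move=> ip; apply/le_anti; rewrite sweep_level_le //=.
  by apply: sweep_level_le; rewrite -?eq_size.
have eq_nth := eq_nth_of_sweep_index eq_sweep.
have eq_index n : (n < size p)%N -> sweep_index p n = sweep_index q n.
  elim/ltn_ind: n => n IH np; have nq : (n < size q)%N by rewrite -eq_size.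
  have eq_index_lt m : (m < n)%N -> sweep_index p m = sweep_index q m.
    by move=> mn; apply: IH; rewrite // (ltn_trans mn).
  have eq_level_n : level p n = level q n.
    apply: (eq_level eq_start (ltnW np) (ltnW nq)) => m mn.
    by rewrite eq_nth ?eq_index_lt // (ltn_trans mn).
  apply/anti_leq/andP; split; apply: sweep_index_le_of_prefix => //.
  - by move=> i iq; rewrite eq_sweep_level // eq_size.
  - by move=> m mn; rewrite eq_index_lt.
by apply: (@eq_from_nth _ 0) => // n np; rewrite eq_nth ?eq_index.
Qed.

Lemma finite_incomplete_dyck (B : {mset int}) : finite_set (incomplete_dyck B).
Proof.
apply: sub_finite_set (finite_seq (permutations B)) => p [pB _ _] /=.
by rewrite mem_permutations; apply/eq_seq_msetP; rewrite pB seq_mset_id.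
Qed.

Lemma sweep_incomplete_dyck (B : {mset int}) (p : seq int) :
  incomplete_dyck B p -> incomplete_dyck B (sweep p).
Proof.
case=> pB p_start p_nneg; split.
- by rewrite -pB; apply/eq_seq_msetP; exact: perm_sweep.
- by rewrite start_level_sweep.
- exact: sweep_nonneg.
Qed.

Theorem theorem3 (B : {mset int}) (hB : \sum_(b <- B) b < 0) :
  set_bij (incomplete_dyck B) (incomplete_dyck B) sweep.
Proof.
apply: finite_set_inj_bij.
- exact: finite_incomplete_dyck.
- exact: sweep_incomplete_dyck.
- by move=> p q; rewrite !inE => -[_ _ p_nneg] [_ _ q_nneg]; exact: sweep_inj.
Qed.
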